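(* Let $\ell^{OI}$ be a line in a Desargues affine plane, with its skew field structure $(\ell^{OI},+,\cdot)$ given by addition and multiplication of points. Let $A,C,D\in\ell^{OI}$ be three fixed, pairwise different points, each different from $O$. For $X\in\ell^{OI}$ put $f_B(X)=c_r(A,X;C,D)=[(A-D)^{-1}(X-D)][(X-C)^{-1}(A-C)]$ and let $\mathcal{R}^{B}_4=\{f_B(X)\mid X\in\ell^{OI}\}$. Then the elements $f_B(\cdot)$ of $\mathcal{R}^{B}_4$, with addition of points, satisfy: (1) associativity: $[f_B(X)+f_B(Y)]+f_B(Z)=f_B(X)+[f_B(Y)+f_B(Z)]$ for all $X,Y,Z\in\ell^{OI}$; (2) commutativity: $f_B(X)+f_B(Y)=f_B(Y)+f_B(X)$ for all $X,Y\in\ell^{OI}$; (3) existence of a neutral (zero) element: there is $Z\in\ell^{OI}$ such that $f_B(X)+f_B(Z)=f_B(X)$ for all $X\in\ell^{OI}$.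
   Context: A Desargues affine plane is an affine plane (two distinct points lie on exactly one line; through a point $P$ not on a line $\ell$ passes exactly one line disjoint from $\ell$; there are three non-collinear points) satisfying Desargues' axiom: if $\ell^{AA'},\ell^{BB'},\ell^{CC'},\ell^{AC},\ell^{A'C'}$ are pairwise distinct lines such that $\ell^{AA'},\ell^{BB'},\ell^{CC'}$ are all parallel or all meet in one point $P$, and if $\ell^{AB}\parallel\ell^{A'B'}$, $\ell^{BC}\parallel\ell^{B'C'}$, $A\ne C$, $A'\ne C'$, $\ell^{AB}\ne\ell^{A'B'}$, $\ell^{BC}\ne\ell^{B'C'}$, then $\ell^{AC}\parallel\ell^{A'C'}$. Here $\ell^{PQ}$ is the line through $P,Q$, and $\ell^{R}_{PQ}$ is the line through $R$ parallel to $\ell^{PQ}$. Fix a line $\ell^{OI}$ through two distinct points $O,I$. For $A,B\in\ell^{OI}$ and an auxiliary point $B_1\notin\ell^{OI}$: addition: $P_1=\ell^{B_1}_{OI}\cap\ell^{A}_{OB_1}$ and $A+B=\ell^{P_1}_{BB_1}\cap\ell^{OI}$; multiplication: $P_1=\ell^{A}_{IB_1}\cap\ell^{OB_1}$ and $A\cdot B=\ell^{P_1}_{BB_1}\cap\ell^{OI}$. It is known that $(\ell^{OI},+,\cdot)$ is a skew field (division ring) with zero $O$ and unit $I$. Cross-ratio: for four points $A,B,C,D\in\ell^{OI}$, no three of them equal, $c_r(A,B;C,D)=[(A-D)^{-1}(B-D)][(B-C)^{-1}(A-C)]$, computed in this skew field. The paper writes the cross-ratio for all $X\in\ell^{OI}$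 and gives no separate convention for a value of $X$ at which an inverse of $O$ would occur. The subscript $B$ in $f_B$ and superscript $B$ in $\mathcal{R}^{B}_4$ only indicate which of the four positions is variable. *)

(* Defs.v *)
From Stdlib Require Import List Classical ClassicalEpsilon.
Import ListNotations.

Set Implicit Arguments.
Unset Strict Implicit.
Unset Printing Implicit Defensive.

Record incidence_structure : Type := {
  point : Type;
  line : Type;
  on : point -> line -> Prop
}.

Arguments on {i} P l.

Section Incidence.
Variable S : incidence_structure.
Implicit Types (P Q R : point S) (l m : line S).

(* Parallelism is reflexive. *)
Definition parallel l m : Prop :=
  l = m \/ ~ (exists P, on P l /\ on P m).

(* [is_join P Q l] says that [l] is the line PQ; the notation "line PQ" is
   only meaningful for distinct points, hence the first conjunct. *)
Definition is_join P Q l : Prop := P <> Q /\ on P l /\ on Q l.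

Definition on_join (X : point S) P Q : Prop := exists l, is_join P Q l /\ on X l.

(* [X] lies on the line through [R] parallel to the line PQ. *)
Definition on_parallel (X : point S) R P Q : Prop :=
  exists l m, is_join P Q l /\ on R m /\ parallel m l /\ on X m.

Definition desargues_axiom : Prop :=
  forall (A B C A' B' C' : point S)
         (aa' bb' cc' ab a'b' bc b'c' ac a'c' : line S),
    is_join A A' aa' -> is_join B B' bb' -> is_join C C' cc' ->
    is_join A B ab -> is_join A' B' a'b' ->
    is_join B C bc -> is_join B' C' b'c' ->
    is_join A C ac -> is_join A' C' a'c' ->
    NoDup [aa'; bb'; cc'; ac; a'c'] ->
    (parallel aa' bb' /\ parallel bb' cc' /\ parallel aa' cc') \/
      (exists P, on P aa' /\ on P bb' /\ on P cc') ->
    parallel ab a'b' -> parallel bc b'c' ->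
    ab <> a'b' -> bc <> b'c' ->
    parallel ac a'c'.

Record desargues_affine_plane : Prop := {
  join_unique : forall P Q, P <> Q -> exists! l, on P l /\ on Q l;
  parallel_unique : forall P l, ~ on P l ->
    exists! m, on P m /\ ~ (exists Q, on Q m /\ on Q l);
  noncollinear : exists P Q R, ~ (exists l, on P l /\ on Q l /\ on R l);
  desargues : desargues_axiom
}.

Definition point_on (l : line S) : Type := {P : point S | on P l}.

Definition pt (l : line S) (A : point_on l) : point S := proj1_sig A.
Coercion pt : point_on >-> point.

Section Operations.
Variable l : line S.
Variables O I : point_on l.
Implicit Types A B C D T X U : point_on l.

(* The result [T] does not depend on the auxiliary point [B1]; here [l] is
   the line OI, so [T] is already known to lie on it. *)
Definition is_sum A B T : Prop :=
  exists B1 P1 : point S,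
    ~ on B1 l /\
    on_parallel P1 B1 O I /\ on_parallel P1 A O B1 /\
    on_parallel T P1 B B1.

Definition is_product A B T : Prop :=
  exists B1 P1 : point S,
    ~ on B1 l /\
    on_parallel P1 A I B1 /\ on_join P1 O B1 /\
    on_parallel T P1 B B1.

Definition add A B : point_on l := epsilon (inhabits O) (is_sum A B).

Definition mul A B : point_on l := epsilon (inhabits O) (is_product A B).

Definition opp A : point_on l :=
  epsilon (inhabits O) (fun X => add A X = O).

Definition sub A B : point_on l := add A (opp B).

(* The inverse of the skew field, extended to [O] by an arbitrary value [U]. *)
Definition inv U A : point_on l :=
  if excluded_middle_informative (A = O) then U
  else epsilon (inhabits O) (fun X => mul A X = I /\ mul X A = I).

(* Cross-ratio c_r(A,B;C,D). The parameter [U] is the value given to the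
   inverse of [O]; it is irrelevant when A <> D and B <> C. *)
Definition cross_ratio U A B C D : point_on l :=
  mul (mul (inv U (sub A D)) (sub B D)) (mul (inv U (sub B C)) (sub A C)).

End Operations.
End Incidence.

(* Main.v *)
(* The cross-ratio with D in the variable position is O, because D - D = O and
   O annihilates products, so only the commutative group structure of
   (l, +, O) is needed. It comes from translations: the little Desargues
   theorem provides, for all points P and Q, a translation of the plane
   carrying P to Q; a translation is determined by one value, and translations
   commute. If t is the translation with t(O) = A, then A + B = t(B). *)

From Stdlib Require Import Classical ClassicalEpsilon.
Require Import Defs.

Set Implicit Arguments.
Unset Strict Implicit.
Unset Printing Implicit Defensive.

Section Plane.
Variable S : incidence_structure.
Hypothesis HS : desargues_affine_plane S.
Implicit Types (P Q R X Y : point S) (l m n d e f g : line S).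

(** * Parallel lines and parallel classes *)

Lemma join_eq P Q l m :
  P <> Q -> on P l -> on Q l -> on P m -> on Q m -> l = m.
Proof.
  intros ne Pl Ql Pm Qm.
  destruct (join_unique HS ne) as [k [_ uk]].
  now rewrite <- (uk l), <- (uk m).
Qed.

Lemma parallel_sym l m : parallel l m -> parallel m l.
Proof.
  intros [-> | no]; [now left | right].
  intros [P []]; apply no; eauto.
Qed.

Lemma parallel_meet l m P : parallel l m -> on P l -> on P m -> l = m.
Proof. intros [e | no] Pl Pm; [exact e | exfalso; eauto]. Qed.

Lemma parallel_through P l : exists m, on P m /\ parallel m l.
Proof.
  destruct (classic (on P l)) as [Pl | nPl].
  - exists l; split; [exact Pl | now left].
  - destruct (parallel_unique HS nPl) as [m [[Pm no] _]].
    exists m; split; [exact Pm | now right].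
Qed.

(** If [l] and [n] meet at a point off [m], both are the unique line through that point disjoint
    from [m]. *)
Lemma parallel_trans l m n : parallel l m -> parallel m n -> parallel l n.
Proof.
  intros lm mn.
  destruct (classic (exists P, on P l /\ on P n)) as [[P [Pl Pn]] | no];
    [left | now right].
  destruct (classic (on P m)) as [Pm | nPm].
  - rewrite (parallel_meet lm Pl Pm); exact (parallel_meet mn Pm Pn).
  - destruct (parallel_unique HS nPm) as [k [_ uk]].
    rewrite <- (uk l), <- (uk n); try reflexivity; split; trivial.
    + destruct mn as [<- | no]; [easy |].
      intros [Q []]; apply no; eauto.
    + destruct lm as [-> | no]; easy.
Qed.

(* A line [d] stands for its parallel class: [along d P Q] says that P and Q
   lie on a common line of that class, also when P = Q. *)
Definition along d P Q : Prop := exists m, parallel m d /\ on P m /\ on Q m.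

Lemma along_refl d P : along d P P.
Proof. destruct (parallel_through P d) as [m []]; exists m; auto. Qed.

Lemma along_sym d P Q : along d P Q -> along d Q P.
Proof. intros [m [? []]]; exists m; auto. Qed.

Lemma along_trans d P Q R : along d P Q -> along d Q R -> along d P R.
Proof.
  intros [m [md [Pm Qm]]] [n [nd [Qn Rn]]].
  assert (mn : m = n).
  { apply (parallel_meet (P := Q)); trivial.
    exact (parallel_trans md (parallel_sym nd)). }
  subst n; exists m; auto.
Qed.

Lemma along_parallel d e P Q : parallel d e -> along d P Q -> along e P Q.
Proof.
  intros de [m [md PQ]]; exists m; split; [exact (parallel_trans md de) | easy].
Qed.

Lemma along_of_line l P Q : on P l -> on Q l -> along l P Q.
Proof. intros; exists l; repeat split; trivial; now left. Qed.

Lemma on_of_along l P Q : on P l -> along l P Q -> on Q l.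
Proof.
  intros Pl [m [ml [Pm Qm]]].
  now rewrite <- (parallel_meet ml Pm Pl).
Qed.

Lemma along_direction d e P Q :
  P <> Q -> along d P Q -> along e P Q -> parallel d e.
Proof.
  intros ne [m [md [Pm Qm]]] [n [nd [Pn Qn]]].
  rewrite (join_eq ne Pm Qm Pn Qn) in md.
  exact (parallel_trans (parallel_sym md) nd).
Qed.

(** The main tool for proving points equal: lines of two different classes share at most one
    point. *)
Lemma along_inter d e P Q :
  ~ parallel d e -> along d P Q -> along e P Q -> P = Q.
Proof. intros nde dPQ ePQ; apply NNPP; eauto using along_direction. Qed.

Lemma along_meet d e P Q :
  ~ parallel d e -> exists R, along d P R /\ along e Q R.
Proof.
  intros nde.
  destruct (parallel_through P d) as [m [Pm md]].
  destruct (parallel_through Q e) as [n [Qn ne]].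
  destruct (classic (exists R, on R m /\ on R n)) as [[R []] | no].
  - exists R; split; [exists m | exists n]; auto.
  - exfalso; apply nde.
    apply (parallel_trans (parallel_sym md)), (fun mn => parallel_trans mn ne).
    now right.
Qed.

Lemma along_neq d P Q : ~ along d P Q -> P <> Q.
Proof. intros n ->; apply n, along_refl. Qed.

Lemma not_along_shift d P P' Q Q' :
  along d P P' -> along d Q Q' -> ~ along d P Q -> ~ along d P' Q'.
Proof.
  intros dP dQ n dPQ; apply n, (along_trans dP), (along_trans dPQ).
  now apply along_sym.
Qed.

(** * The little Desargues theorem *)

(** Desargues' axiom for parallel lines AA', BB', CC'. Phrased by [along], it admits A = A', so the
    axiom is applied only once the case of a fixed vertex is split off. *)
Lemma little_desargues d e f g A B C A' B' C' :
  along d A A' -> along d B B' -> along d C C' ->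
  ~ along d A B -> ~ along d B C -> ~ along d A C ->
  along e A B -> along e A' B' -> along f B C -> along f B' C' ->
  along g A C -> along g A' C'.
Proof.
  intros dA dB dC nAB nBC nAC eAB eAB' fBC fBC' gAC.
  assert (nde : ~ parallel d e).
  { intros de; apply nAB, (along_parallel (parallel_sym de)), eAB. }
  assert (ndf : ~ parallel d f).
  { intros df; apply nBC, (along_parallel (parallel_sym df)), fBC. }
  assert (nAB' := not_along_shift dA dB nAB).
  assert (nBC' := not_along_shift dB dC nBC).
  assert (nAC' := not_along_shift dA dC nAC).
  (* A fixed vertex fixes its neighbours along AB and BC, so the three vertices are all fixed or all
     moved. *)
  assert (fixed : forall h X Y X' Y', ~ parallel d h ->
    along h X Y -> along h X' Y' -> along d Y Y' -> X = X' -> Y = Y').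
  { intros h X Y X' Y' ndh hXY hXY' dY <-; apply (along_inter ndh); trivial.
    exact (along_trans (along_sym hXY) hXY'). }
  assert (stepAB : A = A' -> B = B') by (apply (fixed e); trivial).
  assert (stepBA : B = B' -> A = A')
    by (apply (fixed e); auto using along_sym).
  assert (stepBC : B = B' -> C = C') by (apply (fixed f); trivial).
  assert (stepCB : C = C' -> B = B')
    by (apply (fixed f); auto using along_sym).
  destruct (classic (A = A')) as [eA | neA].
  { rewrite <- eA, <- stepBC; auto. }
  assert (neB : B <> B') by auto.
  assert (neC : C <> C') by auto.
  destruct dA as [aa' [da [Aa A'a]]], dB as [bb' [db [Bb B'b]]],
    dC as [cc' [dc [Cc C'c]]].
  destruct eAB as [ab [eab [Aab Bab]]], eAB' as [ab' [eab' [Aab' Bab']]].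
  destruct fBC as [bc [fbc [Bbc Cbc]]], fBC' as [bc' [fbc' [Bbc' Cbc']]].
  destruct gAC as [ac [gac [Aac Cac]]].
  destruct (join_unique HS (along_neq nAC')) as [ac' [[Aac' Cac'] _]].
  assert (apart : forall m X Y,
    parallel m d -> on X m -> ~ along d X Y -> ~ on Y m).
  { intros m X Y md Xm nXY Ym; apply nXY; exists m; auto. }
  assert (neq : forall m n X, on X m -> ~ on X n -> m <> n).
  { intros m n X Xm nXn ->; auto. }
  assert (nCA := fun H => nAC (along_sym H)).
  assert (nCA' := fun H => nAC' (along_sym H)).
  assert (nBA := fun H => nAB (along_sym H)).
  assert (nBA' := fun H => nAB' (along_sym H)).
  (* Otherwise AC would be the line AA' and contain C. This separates [ac] from [ac']. *)
  assert (nAa' : ~ on A' ac).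
  { intros A'c; rewrite <- (join_eq neA Aa A'a Aac A'c) in Cac.
    exact (apart _ _ _ da Aa nAC Cac). }
  exists ac'; split; [| easy].
  refine (parallel_trans _ gac); apply parallel_sym.
  apply (@desargues _ HS A B C A' B' C' aa' bb' cc' ab ab' bc bc');
    try (split; [eauto using along_neq | easy]).
  (* Each of the ten pairs of lines is told apart by a point on one and off the other. *)
  - constructor; [| constructor; [| constructor; [| constructor;
      [| constructor; [easy | constructor]]]]]; simpl; intros H;
      repeat destruct H as [H | H]; try easy; revert H.
    + exact (neq _ _ B Bb (apart _ _ _ da Aa nAB)).
    + exact (neq _ _ C Cc (apart _ _ _ da Aa nAC)).
    + exact (neq _ _ C Cac (apart _ _ _ da Aa nAC)).
    + exact (neq _ _ C' Cac' (apart _ _ _ da A'a nAC')).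
    + exact (neq _ _ C Cc (apart _ _ _ db Bb nBC)).
    + exact (neq _ _ A Aac (apart _ _ _ db Bb nBA)).
    + exact (neq _ _ A' Aac' (apart _ _ _ db B'b nBA')).
    + exact (neq _ _ A Aac (apart _ _ _ dc Cc nCA)).
    + exact (neq _ _ A' Aac' (apart _ _ _ dc C'c nCA')).
    + exact (neq _ _ A' Aac' nAa').
  - assert (par : forall m n, parallel m d -> parallel n d -> parallel m n).
    { intros m n md nd; exact (parallel_trans md (parallel_sym nd)). }
    left; auto.
  - exact (parallel_trans eab (parallel_sym eab')).
  - exact (parallel_trans fbc (parallel_sym fbc')).
  (* A line through A, B, A', B' would be AA', which misses B. *)
  - intros <-.
    rewrite <- (join_eq neA Aa A'a Aab Aab') in Bab.
    exact (apart _ _ _ da Aa nAB Bab).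
  - intros <-.
    rewrite <- (join_eq neC Cc C'c Cbc Cbc') in Bbc.
    exact (apart _ _ _ dc Cc (fun H => nBC (along_sym H)) Bbc).
Qed.

Lemma along_exists P Q : P <> Q -> exists d, along d P Q.
Proof.
  intros ne; destruct (join_unique HS ne) as [d [[] _]].
  exists d; now apply along_of_line.
Qed.

(* Every parallel class has at least three lines; fails in the plane of
   order 2. *)
Definition thick : Prop :=
  forall d P Q, exists R, ~ along d P R /\ ~ along d Q R.

Hypothesis HT : thick.

(** * Translations: uniqueness and composition *)

(** A dilatation whose traces all lie in one parallel class. The identity is included, with any
    class as direction. *)
Definition translation (t : point S -> point S) : Prop :=
  (forall d P Q, along d P Q -> along d (t P) (t Q)) /\
  exists d, forall P, along d P (t P).

Lemma translation_direction t d P X :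
  translation t -> t P <> P -> along d P (t P) -> along d X (t X).
Proof.
  intros [_ [e He]] ne dP.
  apply (along_parallel (d := e)); [| apply He].
  apply (along_direction (P := P) (Q := t P)); auto.
Qed.

(** Off the [d]-line of [P], the image of [X] is the intersection of the [d]-line of [X] with the
    parallel to PX through the image of [P]. *)
Lemma translation_ext_direction s t d P :
  translation s -> translation t ->
  (forall X, along d X (s X)) -> (forall X, along d X (t X)) ->
  s P = t P -> forall X, s X = t X.
Proof.
  intros [ps _] [pt _] ds dt st.
  assert (off : forall P X, s P = t P -> ~ along d P X -> s X = t X).
  { clear P st; intros P X st n.
    destruct (along_exists (along_neq n)) as [e ePX].
    apply (along_inter (d := d) (e := e)).
    - intros de; apply n, (along_parallel (parallel_sym de)), ePX.
    - exact (along_trans (along_sym (ds X)) (dt X)).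
    - apply (along_trans (along_sym (ps _ _ _ ePX))).
      rewrite st; exact (pt _ _ _ ePX). }
  (* Since [X] may lie on the [d]-line of [P], the argument passes through a point [R] off the
     [d]-lines of both. *)
  intros X; destruct (HT d P X) as [R [nPR nXR]].
  apply (off R); [now apply (off P) |].
  intros H; exact (nXR (along_sym H)).
Qed.

Lemma translation_id d : translation (fun P => P).
Proof. split; [easy |]; exists d; intros P; apply along_refl. Qed.

Lemma translation_fixed t P : translation t -> t P = P -> forall X, t X = X.
Proof.
  intros Ht tP; pose proof Ht as [_ [d dt]].
  apply (translation_ext_direction (t := fun X => X) (d := d) (P := P)); trivial.
  - exact (translation_id d).
  - intros X; apply along_refl.
Qed.

Lemma translation_ext s t P :
  translation s -> translation t -> s P = t P -> forall X, s X = t X.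
Proof.
  intros Hs Ht st X.
  destruct (classic (t P = P)) as [tP | ne].
  - rewrite (translation_fixed Ht tP).
    apply (translation_fixed (P := P)); congruence.
  - destruct (along_exists (not_eq_sym ne)) as [d dP].
    apply (translation_ext_direction (d := d) (P := P)); trivial; intros Y.
    + apply (translation_direction (P := P)); congruence.
    + apply (translation_direction (P := P)); congruence.
Qed.

(** Only a common direction has to be found. If some point is fixed, [s] undoes [t] there, so both
    are the identity or both move along the same class. If none is fixed, traces cannot cross. *)
Lemma translation_comp s t :
  translation s -> translation t -> translation (fun P => s (t P)).
Proof.
  intros Hs Ht; split; [intros d P Q H; now apply Hs, Ht |].
  destruct (classic (exists P, s (t P) = P)) as [[P fP] | nofix].
  - destruct (classic (t P = P)) as [tP | ne].
    + pose proof Ht as [_ [d dt]].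
      exists d; intros X.
      rewrite (translation_fixed Ht tP), (translation_fixed (t := s) (P := P));
        [apply along_refl | trivial | congruence].
    + destruct (along_exists (not_eq_sym ne)) as [d dP].
      exists d; intros X; apply (along_trans (Q := t X)).
      * now apply (translation_direction (P := P)).
      * apply (translation_direction (P := t P)); try congruence.
        rewrite fP; now apply along_sym.
  - destruct (noncollinear HS) as [P _].
    assert (ne : P <> s (t P)) by (intros e; apply nofix; now exists P).
    destruct (along_exists ne) as [d dP].
    exists d; intros X.
    assert (neX : X <> s (t X)) by (intros e; apply nofix; now exists X).
    destruct (along_exists neX) as [f fX].
    destruct (classic (parallel d f)) as [df | ndf].
    { exact (along_parallel (parallel_sym df) fX). }
    (* Otherwise the traces through P and X would meet in a fixed point. *)
    exfalso; apply nofix.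
    destruct (along_meet P X ndf) as [R [dPR fXR]].
    exists R; apply (along_inter ndf).
    + apply (along_trans (Q := s (t P))).
      * now apply along_sym, Hs, Ht.
      * exact (along_trans (along_sym dP) dPR).
    + apply (along_trans (Q := s (t X))).
      * now apply along_sym, Hs, Ht.
      * exact (along_trans (along_sym fX) fXR).
Qed.

(** Both sides lie on the [d]-line of [t X] and on the [e]-line of [s X]. *)
Lemma translation_comm_transverse s t d e :
  translation s -> translation t -> ~ parallel d e ->
  (forall X, along d X (s X)) -> (forall X, along e X (t X)) ->
  forall X, s (t X) = t (s X).
Proof.
  intros [ps _] [pt _] nde ds et X; apply (along_inter nde).
  - exact (along_trans (along_sym (ds (t X))) (pt _ _ _ (ds X))).
  - exact (along_trans (along_sym (ps _ _ _ (et X))) (et (s X))).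
Qed.

(** * Existence of translations by parallelogram completion *)

(* [displaces d P Q X X']: the vectors PQ and XX' are opposite sides of a
   non-degenerate parallelogram, in the direction [d]. *)
Definition displaces d P Q X X' : Prop :=
  ~ along d P X /\ along d P Q /\ along d X X' /\
  forall e, along e P X -> along e Q X'.

Lemma displaces_exists d P Q X :
  along d P Q -> ~ along d P X -> exists X', displaces d P Q X X'.
Proof.
  intros dPQ n; destruct (along_exists (along_neq n)) as [e ePX].
  assert (nde : ~ parallel d e).
  { intros de; apply n, (along_parallel (parallel_sym de)), ePX. }
  destruct (along_meet X Q nde) as [X' [dX eQ]].
  exists X'; repeat split; trivial.
  intros f fPX; apply (along_parallel (d := e)); trivial.
  exact (along_direction (along_neq n) ePX fPX).
Qed.

(** Little Desargues for the triangles X, P, Y and X', P', Y'. *)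
Lemma displaces_trans d P P' X X' Y Y' :
  displaces d P P' X X' -> displaces d P P' Y Y' -> ~ along d X Y ->
  displaces d X X' Y Y'.
Proof.
  intros [nPX [dP [dX pX]]] [nPY [_ [dY pY]]] nXY.
  repeat split; trivial; intros g gXY.
  destruct (along_exists (along_neq nPX)) as [e ePX].
  destruct (along_exists (along_neq nPY)) as [f fPY].
  apply (little_desargues (d := d) (e := e) (f := f) (A := X) (B := P) (C := Y)
    (B' := P')); auto using along_sym.
Qed.

(** The map completes parallelograms on PQ for points off the [d]-line of [P], and on a displaced
    copy RR' for points of that line. *)
Lemma translation_exists d P Q :
  along d P Q -> exists t, translation t /\ t P = Q.
Proof.
  intros dPQ.
  destruct (HT d P P) as [R [nPR _]].
  destruct (displaces_exists dPQ nPR) as [R' PR].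
  assert (graph : forall X, exists X',
    (~ along d P X -> displaces d P Q X X') /\
    (along d P X -> displaces d R R' X X')).
  { intros X; destruct (classic (along d P X)) as [dPX | nPX].
    - destruct (@displaces_exists d R R' X) as [X' HX']; [apply PR | |].
      + intros H; exact (nPR (along_trans dPX (along_sym H))).
      + exists X'; now split.
    - destruct (displaces_exists dPQ nPX) as [X' HX']; exists X'; now split. }
  destruct (ClassicalEpsilon.choice _ graph) as [t Ht]; clear graph.
  assert (atP : forall X, ~ along d P X -> displaces d P Q X (t X)) by apply Ht.
  assert (atR : forall X, ~ along d R X -> displaces d R R' X (t X)).
  { intros X nRX; destruct (classic (along d P X)) as [dPX | nPX].
    - now apply Ht.
    - now apply (displaces_trans PR); auto. }
  assert (dt : forall X, along d X (t X)).
  { intros X; destruct (classic (along d P X)) as [dPX | nPX].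
    - now apply Ht.
    - now apply atP. }
  assert (nRP : ~ along d R P) by (intros H; exact (nPR (along_sym H))).
  exists t; split; [split; [| now exists d] |].
  - intros g X Y gXY.
    destruct (classic (along d X Y)) as [dXY | nXY].
    { destruct (classic (X = Y)) as [-> | ne]; [apply along_refl |].
      apply (along_parallel (along_direction ne dXY gXY)).
      exact (along_trans (along_sym (dt X)) (along_trans dXY (dt Y))). }
    enough (XY : displaces d X (t X) Y (t Y)) by apply XY, gXY.
    destruct (classic (along d P X \/ along d P Y)) as [onP | offP].
    2: { apply (displaces_trans (P := P) (P' := Q)); try apply atP; tauto. }
    destruct (classic (along d R X \/ along d R Y)) as [onR | offR].
    2: { apply (displaces_trans (P := R) (P' := R')); try apply atR; tauto. }
    (* It remains that one of [X], [Y] lies on the [d]-line of [P] and the other on that of [R]. The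
       point [T], off both lines, is a base that serves for both. *)
    destruct (HT d P R) as [T [nPT nRT]].
    assert (TT := atP T nPT).
    assert (atT : forall Z, along d P Z \/ along d R Z ->
      displaces d T (t T) Z (t Z)).
    { intros Z HZ.
      assert (nTZ : ~ along d T Z).
      { intros H; destruct HZ as [HZ | HZ];
          [apply nPT | apply nRT]; exact (along_trans HZ (along_sym H)). }
      destruct HZ as [PZ | RZ].
      - apply (displaces_trans (atR T nRT)); trivial; apply atR.
        intros H; exact (nPR (along_trans PZ (along_sym H))).
      - apply (displaces_trans (atP T nPT)); trivial; apply atP.
        intros H; exact (nRP (along_trans RZ (along_sym H))). }
    apply (displaces_trans (P := T) (P' := t T)); trivial; apply atT.
    + destruct onP as [? | PY]; auto; destruct onR as [? | RY]; auto.
      exfalso; exact (nPR (along_trans PY (along_sym RY))).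
    + destruct onP as [PX | ?]; auto; destruct onR as [RX | ?]; auto.
      exfalso; exact (nPR (along_trans PX (along_sym RX))).
  (* Both [t P] and [Q] lie on the [d]-line of [P] and on the parallel to PR through [R']. *)
  - destruct (along_exists (along_neq nPR)) as [e ePR].
    assert (nde : ~ parallel d e).
    { intros de; apply nPR, (along_parallel (parallel_sym de)), ePR. }
    apply (along_inter nde).
    + exact (along_trans (along_sym (dt P)) dPQ).
    + apply (along_trans (Q := R')).
      * now apply along_sym, (atR P nRP), along_sym.
      * now apply along_sym, PR.
Qed.

(** * Commutativity of translations *)

Lemma translation_comm s t :
  translation s -> translation t -> forall X, s (t X) = t (s X).
Proof.
  intros Hs Ht X.
  destruct (classic (s X = X)) as [sX | ne].
  { now rewrite !(translation_fixed Hs sX). }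
  pose proof Hs as [_ [d ds]]; pose proof Ht as [_ [e et]].
  destruct (classic (parallel d e)) as [de | nde];
    [| exact (translation_comm_transverse Hs Ht nde ds et X)].
  (* Parallel translations: both commute with a transverse [u], and [t]
     commutes with the composite [s u], which is transverse to [t]. *)
  destruct (HT d X X) as [R [nXR _]].
  destruct (along_exists (along_neq nXR)) as [g gXR].
  destruct (translation_exists gXR) as [u [Hu uX]].
  assert (neu : u X <> X) by (rewrite uX; exact (not_eq_sym (along_neq nXR))).
  assert (gu : forall Y, along g Y (u Y)).
  { intros Y; apply (translation_direction (P := X)); trivial.
    now rewrite uX. }
  assert (Hsu := translation_comp Hs Hu).
  pose proof Hsu as [_ [f fsu]].
  assert (dXR : forall h, parallel h d -> ~ along h X R).
  { intros h hd H; exact (nXR (along_parallel hd H)). }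
  assert (neg : ~ parallel g e).
  { intros ge; apply (dXR g); trivial.
    exact (parallel_trans ge (parallel_sym de)). }
  (* Otherwise [s (u X)] would lie on the [d]-line of [X]; it also lies on that of [u X], which is
     [R]. *)
  assert (nfe : ~ parallel f e).
  { intros fe.
    assert (fd := parallel_trans fe (parallel_sym de)).
    apply nXR, (along_trans (Q := s (u X))).
    - exact (along_parallel fd (fsu X)).
    - rewrite <- uX; now apply along_sym. }
  assert (tu := translation_comm_transverse Hu Ht neg gu et X).
  assert (tsu := translation_comm_transverse Hsu Ht nfe fsu et X).
  (* The two composites of [s] and [t] now agree at [u X], hence everywhere. *)
  cbv beta in tsu; rewrite tu in tsu.
  exact (translation_ext (translation_comp Hs Ht) (translation_comp Ht Hs)
    tsu X).
Qed.

(** * Addition of points through translations *)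

Section Points.
Variables (l : line S) (O I : point_on l).
Hypothesis hOI : O <> I.
Implicit Types A B T : point_on l.

Lemma pt_inj A B : pt A = pt B -> A = B.
Proof.
  destruct A as [A hA], B as [B hB]; simpl; intros <-.
  now rewrite (proof_irrelevance _ hA hB).
Qed.

Lemma pt_on A : on (pt A) l.
Proof. exact (proj2_sig A). Qed.

Lemma along_points A B : along l A B.
Proof. apply along_of_line; apply pt_on. Qed.

Lemma point_of_along A P : along l A P -> exists T, pt T = P.
Proof.
  intros H; assert (Pl : on P l) by exact (on_of_along (pt_on A) H).
  now exists (exist _ P Pl).
Qed.

Lemma off_line_exists : exists P, ~ on P l.
Proof.
  destruct (noncollinear HS) as [P [Q [R nc]]].
  apply NNPP; intros no; apply nc; exists l.
  repeat split; apply NNPP; eauto.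
Qed.

Lemma off_neq A P : ~ on P l -> pt A <> P.
Proof. intros nP <-; apply nP, pt_on. Qed.

Lemma is_join_OI : is_join (pt O) (pt I) l.
Proof.
  split; [| split; apply pt_on].
  intros e; apply hOI, pt_inj, e.
Qed.

Lemma is_join_exists P Q : P <> Q -> exists k, is_join P Q k.
Proof.
  intros ne; destruct (join_unique HS ne) as [k [[] _]].
  now exists k.
Qed.

Lemma on_parallelP X R P Q k :
  is_join P Q k -> on_parallel X R P Q <-> along k R X.
Proof.
  intros [ne [Pk Qk]]; split.
  - intros [k' [m [[_ [Pk' Qk']] [Rm [mk' Xm]]]]].
    rewrite (join_eq ne Pk' Qk' Pk Qk) in mk'; exists m; auto.
  - intros [m [mk [Rm Xm]]]; exists k, m; repeat split; trivial.
Qed.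

Lemma on_joinP X P Q k : is_join P Q k -> on_join X P Q <-> along k P X.
Proof.
  intros [ne [Pk Qk]]; split.
  - intros [k' [[_ [Pk' Qk']] Xk']].
    rewrite (join_eq ne Pk' Qk' Pk Qk) in Xk'; now apply along_of_line.
  - intros H; exists k; repeat split; trivial; exact (on_of_along Pk H).
Qed.

Lemma transverse_join A P k : ~ on P l -> is_join (pt A) P k -> ~ parallel l k.
Proof.
  intros nP [_ [Ak Pk]] lk; apply nP.
  now rewrite (parallel_meet lk (pt_on A) Ak).
Qed.

Lemma joins_not_parallel A B P k m :
  A <> B -> ~ on P l -> is_join (pt A) P k -> is_join (pt B) P m ->
  ~ parallel m k.
Proof.
  intros ne nP [_ [Ak Pk]] [_ [Bm Pm]] mk.
  rewrite (parallel_meet mk Pm Pk) in Bm; apply nP.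
  rewrite (join_eq (P := pt A) (Q := pt B) (l := l) (m := k)); trivial;
    try apply pt_on.
  intros e; apply ne, pt_inj, e.
Qed.

Lemma translation_of_point A : exists t, translation t /\ t (pt O) = pt A.
Proof. exact (translation_exists (along_points O A)). Qed.

Lemma translation_of_point_along t A P :
  translation t -> t (pt O) = pt A -> along l P (t P).
Proof.
  intros Ht tO; destruct (classic (t (pt O) = pt O)) as [e | ne].
  - rewrite (translation_fixed Ht e); apply along_refl.
  - apply (translation_direction (P := pt O)); trivial.
    rewrite tO; apply along_points.
Qed.

(** Every auxiliary [B1] forces P1 = [t B1], the point completing the parallelogram on OA and OB1;
    then T is [t B]. Existence of the sum and independence of [B1] follow together. *)
Lemma is_sumP t A B T :
  translation t -> t (pt O) = pt A -> is_sum O I A B T <-> pt T = t (pt B).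
Proof.
  intros Ht tO.
  assert (lt := fun P => translation_of_point_along P Ht tO).
  split.
  - intros [B1 [P1 [nB1 [H1 [H2 H3]]]]].
    destruct (is_join_exists (off_neq (A := O) nB1)) as [e je].
    destruct (is_join_exists (off_neq (A := B) nB1)) as [f jf].
    apply (on_parallelP _ _ is_join_OI) in H1.
    apply (on_parallelP _ _ je) in H2; apply (on_parallelP _ _ jf) in H3.
    assert (P1 = t B1) as ->.
    { apply (along_inter (transverse_join nB1 je)).
      - exact (along_trans (along_sym H1) (lt B1)).
      - apply (along_trans (along_sym H2)); rewrite <- tO.
        apply Ht, along_of_line; apply je. }
    apply (along_inter (transverse_join nB1 jf)).
    + exact (along_trans (along_points T B) (lt B)).
    + apply (along_trans (along_sym H3)).
      apply Ht, along_of_line; apply jf.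
  - intros eT; destruct off_line_exists as [B1 nB1].
    destruct (is_join_exists (off_neq (A := O) nB1)) as [e je].
    destruct (is_join_exists (off_neq (A := B) nB1)) as [f jf].
    exists B1, (t B1); split; [trivial | split; [| split]].
    + apply (on_parallelP _ _ is_join_OI), lt.
    + apply (on_parallelP _ _ je); rewrite <- tO.
      apply Ht, along_of_line; apply je.
    + apply (on_parallelP _ _ jf); rewrite eT.
      apply Ht, along_of_line; apply jf.
Qed.

Lemma add_translation t A B :
  translation t -> t (pt O) = pt A -> pt (add O I A B) = t (pt B).
Proof.
  intros Ht tO; apply (is_sumP B (add O I A B) Ht tO); unfold add.
  apply epsilon_spec.
  destruct (point_of_along (translation_of_point_along B Ht tO)) as [T eT].
  now exists T; apply (is_sumP B T Ht tO).
Qed.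

Lemma addC A B : add O I A B = add O I B A.
Proof.
  destruct (translation_of_point A) as [s [Hs sO]].
  destruct (translation_of_point B) as [t [Ht tO]].
  apply pt_inj; rewrite (add_translation B Hs sO), (add_translation A Ht tO).
  rewrite <- sO, <- tO; now apply translation_comm.
Qed.

(** The composite of the translations of [A] and [B] is the translation of A + B, so this is
    associativity of composition. *)
Lemma addA A B T : add O I (add O I A B) T = add O I A (add O I B T).
Proof.
  destruct (translation_of_point A) as [s [Hs sO]].
  destruct (translation_of_point B) as [t [Ht tO]].
  apply pt_inj.
  rewrite (add_translation _ Hs sO), (add_translation _ Ht tO).
  apply (add_translation (t := fun P => s (t P))).
  - exact (translation_comp Hs Ht).
  - now rewrite tO, (add_translation _ Hs sO).
Qed.

Lemma addO A : add O I A O = A.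
Proof.
  destruct (translation_of_point A) as [s [Hs sO]].
  now apply pt_inj; rewrite (add_translation _ Hs sO).
Qed.

Lemma add_opp A : add O I A (opp O I A) = O.
Proof.
  unfold opp; apply (epsilon_spec (inhabits O) (fun T => add O I A T = O)).
  destruct (translation_of_point A) as [s [Hs sO]].
  (* The opposite of [A] is the image of [O] under the translation carrying [A] to [O]. *)
  destruct (translation_exists (along_points A O)) as [t [Ht tA]].
  destruct (@point_of_along O (t (pt O))) as [X eX].
  { destruct (classic (t (pt A) = pt A)) as [e | ne].
    - rewrite (translation_fixed Ht e); apply along_refl.
    - apply (translation_direction (P := pt A)); trivial.
      rewrite tA; apply along_points. }
  exists X; apply pt_inj.
  now rewrite (add_translation _ Hs sO), eX, translation_comm, sO.
Qed.

(** * Products with the zero point *)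

(** With second factor [O] the last direction is that of OB1, a line that already contains P1, so it
    meets [l] in [O]. *)
Lemma is_productO A T : is_product O I A O T <-> T = O.
Proof.
  split.
  - intros [B1 [P1 [nB1 [_ [H2 H3]]]]].
    destruct (is_join_exists (off_neq (A := O) nB1)) as [e je].
    apply (on_joinP _ je) in H2; apply (on_parallelP _ _ je) in H3.
    apply pt_inj, (along_inter (transverse_join nB1 je)).
    + apply along_points.
    + exact (along_sym (along_trans H2 H3)).
  - intros ->; destruct off_line_exists as [B1 nB1].
    destruct (is_join_exists (off_neq (A := O) nB1)) as [e je].
    destruct (is_join_exists (off_neq (A := I) nB1)) as [f jf].
    assert (nfe := joins_not_parallel hOI nB1 je jf).
    destruct (along_meet (pt A) (pt O) nfe) as [P1 [fAP eOP]].
    exists B1, P1; split; [trivial | split; [| split]].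
    + now apply (on_parallelP _ _ jf).
    + now apply (on_joinP _ je).
    + now apply (on_parallelP _ _ je), along_sym.
Qed.

Lemma mulO A : mul O I A O = O.
Proof.
  apply (is_productO A); unfold mul; apply epsilon_spec.
  now exists O; apply is_productO.
Qed.

(** The parallel to IB1 through [O] meets OB1 in [O], so P1 is [O], and the last parallel meets [l]
    there. *)
Lemma is_product_O B T : is_product O I O B T <-> T = O.
Proof.
  split.
  - intros [B1 [P1 [nB1 [H1 [H2 H3]]]]].
    destruct (is_join_exists (off_neq (A := O) nB1)) as [e je].
    destruct (is_join_exists (off_neq (A := I) nB1)) as [f jf].
    destruct (is_join_exists (off_neq (A := B) nB1)) as [g jg].
    apply (on_joinP _ je) in H2; apply (on_parallelP _ _ jf) in H1.
    apply (on_parallelP _ _ jg) in H3.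
    rewrite <- (along_inter (joins_not_parallel hOI nB1 je jf) H1 H2) in H3.
    apply pt_inj, (along_inter (transverse_join nB1 jg)).
    + apply along_points.
    + now apply along_sym.
  - intros ->; destruct off_line_exists as [B1 nB1].
    destruct (is_join_exists (off_neq (A := O) nB1)) as [e je].
    destruct (is_join_exists (off_neq (A := I) nB1)) as [f jf].
    destruct (is_join_exists (off_neq (A := B) nB1)) as [g jg].
    exists B1, (pt O); split; [trivial | split; [| split]].
    + apply (on_parallelP _ _ jf), along_refl.
    + apply (on_joinP _ je), along_refl.
    + apply (on_parallelP _ _ jg), along_refl.
Qed.

Lemma Omul B : mul O I O B = O.
Proof.
  apply (is_product_O B); unfold mul; apply epsilon_spec.
  now exists O; apply is_product_O.
Qed.

(** The values of [inv] are never examined: [O] annihilates any factor on either side. *)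
Lemma cross_ratioO (U A C D : point_on l) : cross_ratio O I U A D C D = O.
Proof. unfold cross_ratio, sub at 2; now rewrite add_opp, mulO, Omul. Qed.

End Points.
End Plane.

(** * Thickness from three collinear points *)

(** Pigeonhole: the three points lie on three different [d]-lines, and those of [P] and [Q] are at
    most two. *)
Lemma transverse_thick (S : incidence_structure)
    (HS : desargues_affine_plane S) (d m : line S) (A B C : point S) :
  A <> B -> A <> C -> B <> C -> along m A B -> along m A C ->
  ~ parallel d m ->
  forall P Q, exists R, ~ along d P R /\ ~ along d Q R.
Proof.
  intros nAB nAC nBC mAB mAC nd P Q.
  assert (mBC := along_trans HS (along_sym mAB) mAC).
  assert (sep : forall X Y T, along m X Y -> X <> Y -> along d T X ->
    ~ along d T Y).
  { intros X Y T mXY ne dX dY; apply ne, (along_inter HS nd); trivial.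
    exact (along_trans HS (along_sym dX) dY). }
  apply NNPP; intros no.
  assert (near : forall R, along d P R \/ along d Q R).
  { intros R; apply NNPP; intros n; apply no; exists R; tauto. }
  assert (sAB := fun T => sep _ _ T mAB nAB).
  assert (sAC := fun T => sep _ _ T mAC nAC).
  assert (sBC := fun T => sep _ _ T mBC nBC).
  assert (PAB := sAB P); assert (QAB := sAB Q).
  assert (PAC := sAC P); assert (QAC := sAC Q).
  assert (PBC := sBC P); assert (QBC := sBC Q).
  destruct (near A), (near B), (near C); tauto.
Qed.

(** Rules out the plane of order 2; in the theorem the three points are [A], [C], [D]. *)
Lemma three_points_thick (S : incidence_structure)
    (HS : desargues_affine_plane S) (l : line S) (A B C : point_on l) :
  A <> B -> A <> C -> B <> C -> thick S.
Proof.
  intros nAB nAC nBC d.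
  assert (ptne : forall X Y : point_on l, X <> Y -> pt X <> pt Y).
  { intros X Y ne e; apply ne, pt_inj, e. }
  destruct (classic (parallel d l)) as [dl | ndl];
    [| now apply (transverse_thick HS (m := l) (A := A) (B := B) (C := C));
       auto using along_points].
  (* Project [l] along BM onto the transverse line AM. *)
  destruct (off_line_exists HS l) as [M nM].
  destruct (is_join_exists HS (off_neq (A := A) nM)) as [m jm].
  destruct (is_join_exists HS (off_neq (A := B) nM)) as [e je].
  assert (nlm := transverse_join nM jm).
  assert (nle := transverse_join nM je).
  assert (nem := joins_not_parallel HS nAB nM jm je).
  destruct (along_meet HS (pt B) (pt A) nem) as [B' [eB mB]].
  destruct (along_meet HS (pt C) (pt A) nem) as [C' [eC mC]].
  assert (sep : forall X Y : point_on l, X <> Y -> ~ along e X Y).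
  { intros X Y ne eXY; apply (ptne _ _ ne), (along_inter HS nle); trivial.
    apply along_points. }
  (* The projection fixes [A] and stays injective, because different points of [l] lie on different
     [e]-lines. *)
  apply (transverse_thick HS (m := m) (A := A) (B := B') (C := C')); trivial.
  - intros eA; rewrite <- eA in eB; exact (sep _ _ nAB (along_sym eB)).
  - intros eA; rewrite <- eA in eC; exact (sep _ _ nAC (along_sym eC)).
  - intros eB'; rewrite <- eB' in eC.
    exact (sep _ _ nBC (along_trans HS eB (along_sym eC))).
  - intros dm; exact (nlm (parallel_trans HS (parallel_sym dl) dm)).
Qed.

(** * Addition of cross-ratios *)

Theorem theorem4
  (S : incidence_structure) (HS : desargues_affine_plane S)
  (l : line S) (O I : point_on l) (hOI : O <> I)
  (A C D : point_on l)
  (hAC : A <> C) (hAD : A <> D) (hCD : C <> D)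
  (hA : A <> O) (hC : C <> O) (hD : D <> O)
  (U : point_on l) :
  let fB := fun X : point_on l => cross_ratio O I U A X C D in
  (forall X Y Z : point_on l,
     add O I (add O I (fB X) (fB Y)) (fB Z)
     = add O I (fB X) (add O I (fB Y) (fB Z))) /\
  (forall X Y : point_on l,
     add O I (fB X) (fB Y) = add O I (fB Y) (fB X)) /\
  (exists Z : point_on l, forall X : point_on l,
     add O I (fB X) (fB Z) = fB X).
Proof.
  assert (HT := three_points_thick HS hAC hAD hCD).
  intros fB; split; [| split].
  - intros X Y Z; now apply addA.
  - intros X Y; now apply addC.
  (* At [D] the cross-ratio takes the value [O], the neutral element of addition. *)
  - exists D; intros X; unfold fB at 2.
    rewrite cross_ratioO; trivial; now apply addO.
Qed.
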